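(* Let $p>5$ be a prime. Then $$\sum_{k=1}^{p-1}\frac{1}{k^4\binom{2k}{k}}-3\sum_{k=1}^{p-1}\frac{H_{k-1}(2)}{k^2\binom{2k}{k}}\equiv 0\pmod{p}.$$
   Context: For integers $n\ge 0$ and $a\ge 1$, $H_n(a)=\sum_{k=1}^n \frac{1}{k^a}$ (empty sum is $0$). For rational numbers $x,y$ (whose denominators may be divisible by $p$), $x\equiv y\pmod{p^r}$ means that $x-y$ has $p$-adic valuation at least $r$. *)

(* Defs.v *)
From mathcomp Require Import all_boot all_order all_algebra.

Set Implicit Arguments.
Unset Strict Implicit.
Unset Printing Implicit Defensive.

Import GRing.Theory.
Local Open Scope ring_scope.

Definition harmonic (n a : nat) : rat :=
  \sum_(1 <= k < n.+1) 1 / k%:R ^+ a.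

(* Meaningful for p prime and x != 0 only: at x = 0 this is the junk value 0. *)
Definition padic_val (p : nat) (x : rat) : int :=
  (logn p `|numq x|%N)%:Z - (logn p `|denq x|%N)%:Z.

(* The disjunct x = y accounts for the valuation of 0 being +oo. *)
Definition ratcong (p : nat) (r : int) (x y : rat) : Prop :=
  x = y \/ r <= padic_val p (x - y).

(* Main.v *)
From HB Require Import structures.
Require Import Defs.
From mathcomp Require Import all_boot all_order all_algebra.
From mathcomp Require Import ring zify.
Import GRing.Theory Num.Theory.
Local Open Scope ring_scope.
Set Implicit Arguments.
Unset Strict Implicit.
Unset Printing Implicit Defensive.

(** Let T0 = sum 1/(k^2 C(2k,k)) over 0 < k < p, let T be the combination of
    sums in the theorem, and put N = p - 1.  The Bailey-Borwein-Bradley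
    generating function
      S(x) = sum_(1 <= n <= N) 3 / (C(2n,n) (n^2 - x^2))
               * prod_(m < n) (m^2 - 4x^2) / (m^2 - x^2)
    expands as 3 T0 + 3 T x^2 + O(x^4), so T is reached by comparing S at two
    p-adically small points, namely x = p and x = 2p.

    Completing a Wilf-Zeilberger pair for the untruncated sum and decomposing
    into partial fractions gives, for every N, the exact identity
    [apery_sum_weighted]
      2x C(2N,N) S(x) = Phi(2x) - Phi(-2x),
      Phi(u) = sum_(i <= N) w_i(u) h_i(-u/2),
    where w_i(u) = C(N-u,N-i) C(N+u,i) and h_i(y) = sum_(k <= i) 1/(k+y).
    For N = p - 1 and p-adically small u, Phi is a power series with p-integral
    coefficients, because
      w_i(u) = prod_(j < p) (1 - u/j) * prod_(j <= i) (1 - p/j)(1 - p/(j-u))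
    ([weight_pred]).  With coefficients g_m, the difference Phi(u) - Phi(-u) is
    2 (g_1 u + g_3 u^3 + ...), and p^2 divides g_3 ([coef3_weighted_poly]).  Hence C(2N,N) S(x) is congruent
    to 2 g_1 modulo p^4 at both points x = p and x = 2p; as C(2N,N)
    divides p up to a p-adic unit, p (S(2p) - S(p)) vanishes modulo p^4.  By the
    expansion of S this number is 9 p^3 T modulo p^4, so p divides T.

    The divisibility of g_3 rests on the product over j <= i being linear in
    the harmonic numbers modulo p^2.  The coefficient g_3 then only involves
    H_(p-1)(a) for a <= 4, which p divides, and even p^2 for a = 1 and 3, and
    sums of H_i(a) H_i(b) over i < p with a + b = 5, which the reflection
    i -> p - 1 - i shows to be their own opposites modulo p. *)

(** * Weights and the exact form of the generating function *)

(** The product of generalised binomials C(N - u, N - i) C(N + u, i), given by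
    the recurrence on N that the Wilf-Zeilberger pair provides; it vanishes for
    i > N, so that no truncated subtraction N - i is needed. *)
Fixpoint weight (R : numFieldType) (u : R) (N i : nat) : R :=
  if N is M.+1 then
    ((N%:R + 2 * i%:R - u) * weight u M i
     + (if i is j.+1 then (3 * M%:R + 1 - 2 * j%:R + u) * weight u M j else 0))
    / N%:R
  else (i == 0)%:R.

Lemma weight_gt (R : numFieldType) (u : R) N i :
  (N < i)%N -> weight u N i = 0.
Proof.
elim: N i => [|N IH] [|i] //= lt_Ni.
by rewrite !IH ?mulr0 ?addr0 ?mul0r // ltnW.
Qed.

(** Summation by parts: the recurrence of the weights, moved onto the function
    that they are summed against.  It drives all inductions on N below. *)
Lemma weight_sum_rec (R : numFieldType) (u : R) N (f : nat -> R) :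
  N.+1%:R * \sum_(i < N.+2) weight u N.+1 i * f i
  = \sum_(i < N.+1) weight u N i
      * ((N.+1%:R + 2 * i%:R - u) * f i
         + (3 * N%:R + 1 - 2 * i%:R + u) * f i.+1).
Proof.
have nz : N.+1%:R != 0 :> R by rewrite pnatr_eq0.
have -> : N.+1%:R * \sum_(i < N.+2) weight u N.+1 i * f i
  = \sum_(i < N.+2) (N.+1%:R + 2 * i%:R - u) * weight u N i * f i
    + \sum_(i < N.+2) (if val i is j.+1
        then (3 * N%:R + 1 - 2 * j%:R + u) * weight u N j else 0) * f i.
  rewrite mulr_sumr -big_split; apply: eq_bigr => i _ /=.
  by rewrite -mulrDl mulrA mulrCA divff // mulr1.
rewrite big_ord_recr /= weight_gt // mulr0 mul0r addr0.
rewrite [X in _ + X]big_ord_recl /= mul0r add0r -big_split /=.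
by apply: eq_bigr => i _; rewrite /bump /= add1n; ring.
Qed.

Lemma central_bin_rec N :
  (N.+1 * 'C(2 * N.+1, N.+1) = (4 * N + 2) * 'C(2 * N, N))%N.
Proof.
rewrite -mul_bin_diag mulnS /= add1n.
have <- : 'C((2 * N).+1, N.+1) = 'C((2 * N).+1, N).
  by rewrite -bin_sub; [congr 'C(_, _); lia | lia].
have := mul_bin_diag (2 * N).+1 N; rewrite /= => E.
transitivity (2 * (N.+1 * 'C((2 * N).+1, N.+1)))%N; first by lia.
by rewrite -E; lia.
Qed.

(** Vandermonde's identity; the point is that the sum does not depend on u. *)
Lemma weight_sum (R : numFieldType) (u : R) N :
  \sum_(i < N.+1) weight u N i = 'C(2 * N, N)%:R.
Proof.
elim: N => [|N IH]; first by rewrite big_ord1 /= bin0.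
have nz : N.+1%:R != 0 :> R by rewrite pnatr_eq0.
apply: (mulfI nz).
have := weight_sum_rec u N (fun=> 1).
under eq_bigr do rewrite mulr1.
move=> ->.
have -> : \sum_(i < N.+1) weight u N i * ((N.+1%:R + 2 * i%:R - u) * 1
         + (3 * N%:R + 1 - 2 * i%:R + u) * 1)
   = (4 * N%:R + 2) * \sum_(i < N.+1) weight u N i.
  by rewrite mulr_sumr; apply: eq_bigr => i _; ring.
by rewrite IH -[RHS]natrM central_bin_rec natrM natrD natrM.
Qed.

(** The weights are hypergeometric in i.  Both factors N - i are taken in R, so
    the relation remains true, and is provable by induction, for i >= N. *)
Lemma weight_ratio (R : numFieldType) (u : R) N i :
  (i.+1%:R * (i.+1%:R - u)) * weight u N i.+1
  = ((N%:R - i%:R) * (N%:R - i%:R + u)) * weight u N i.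
Proof.
elim: N i => [|N IH] i.
  by case: i => [|i] /=; ring.
have nz : N.+1%:R != 0 :> R by rewrite pnatr_eq0.
rewrite /= !mulrA; congr (_ / _).
have E := IH i.
case: i E => [|i] E.
  set a := weight u N 1 in E *; set b := weight u N 0 in E *.
  transitivity ((N.+1%:R + 2 - u) * (1%:R * (1%:R - u) * a)
     + (3 * N%:R + 1 + u) * (1 - u) * b); first by ring.
  by rewrite E; ring.
have E' := IH i.
set a := weight u N i.+2 in E *; set b := weight u N i.+1 in E E' *.
set c := weight u N i in E' *.
transitivity ((N.+1%:R + 2 * i.+2%:R - u) * (i.+2%:R * (i.+2%:R - u) * a)
     + i.+2%:R * (i.+2%:R - u) * (3 * N%:R + 1 - 2 * i.+1%:R + u) * b); first by ring.
transitivity ((N.+1%:R - i.+1%:R) * (N.+1%:R - i.+1%:R + u) * (N.+1%:R + 2 * i.+1%:R - u) * b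
     + (3 * N%:R + 1 - 2 * i%:R + u) * ((N%:R - i%:R) * (N%:R - i%:R + u) * c)); last by ring.
by rewrite E -E'; ring.
Qed.

Lemma weight0 (R : numFieldType) (u : R) N :
  weight u N 0 = \prod_(1 <= j < N.+1) (1 - u / j%:R).
Proof.
elim: N => [|N IH]; first by rewrite big_geq.
have nz : N.+1%:R != 0 :> R by rewrite pnatr_eq0.
by rewrite big_nat_recr //= -IH mulr0 !addr0 mulrAC mulrBl divff // mulrC.
Qed.

(** For N = p - 1 the ratio (N - i)(N - i + u) / ((i + 1)(i + 1 - u)) of
    consecutive weights is (1 - p/j)(1 - p/(j - u)) with j = i + 1: it is close
    to 1 in the p-adic sense, which is what makes the p-adic analysis possible. *)
Lemma weight_pred (R : numFieldType) (u : R) p i :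
  (i < p)%N -> (forall j, (0 < j < p)%N -> j%:R - u != 0) ->
  weight u p.-1 i = \prod_(1 <= j < p) (1 - u / j%:R)
    * \prod_(1 <= j < i.+1) ((1 - p%:R / j%:R) * (1 - p%:R / (j%:R - u))).
Proof.
move=> lt_ip nz; have p_gt0 : (0 < p)%N by lia.
elim: i lt_ip => [|i IH] lt_ip.
  by rewrite [X in _ * X]big_geq // mulr1 weight0 prednK.
have nzi : i.+1%:R != 0 :> R by rewrite pnatr_eq0.
have nzu : i.+1%:R - u != 0 by apply: nz; lia.
rewrite (big_nat_recr i.+1) //= !mulrA -IH ?(ltnW lt_ip) //.
apply: (mulfI (mulf_neq0 nzi nzu)).
rewrite weight_ratio -subn1 natrB // -[i.+1%:R]natr1 in nzi nzu *.
by field; rewrite nzi nzu.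
Qed.

(** The weights are the residues, up to sign, at the poles in z of the right-hand
    side, which is proportional to one member of the Wilf-Zeilberger pair.  As
    functions F of N and z, both sides satisfy
      (N+1) F(N+1, z) = (N+1-2z) F(N, z) + (3N+3+2z) F(N, z+1). *)
Lemma weight_partial_fractions (R : numFieldType) (x z : R) N :
  (forall j, (j <= N)%N -> (z + j%:R - x != 0) && (z + j%:R + x != 0)) ->
  \sum_(i < N.+1) weight (2 * x) N i * (z + i%:R - x)^-1
  - \sum_(i < N.+1) weight (- (2 * x)) N i * (z + i%:R + x)^-1
  = 2 * x * \prod_(1 <= j < N.+1) (j%:R ^+ 2 - (2 * x) ^+ 2)
    / \prod_(0 <= j < N.+1) ((z + j%:R) ^+ 2 - x ^+ 2).
Proof.
elim: N z => [|N IH] z nz.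
  have /andP[nzm nzp] := nz 0%N isT.
  rewrite !big_ord1 big_geq // big_nat1 /= -[0%:R]/(0 : R) !addr0 in nzm nzp *.
  rewrite subr_sqr; field.
  by rewrite nzm nzp.
have nzN : N.+1%:R != 0 :> R by rewrite pnatr_eq0.
apply: (mulfI nzN).
rewrite mulrBr (weight_sum_rec (2 * x) N (fun i => (z + i%:R - x)^-1)).
rewrite (weight_sum_rec (- (2 * x)) N (fun i => (z + i%:R + x)^-1)).
have nz1 j : (j <= N)%N ->
    (z + 1 + j%:R - x != 0) && (z + 1 + j%:R + x != 0).
  by move=> le_jN; rewrite -(addrA z) nat1r nz.
have nz0 j : (j <= N)%N -> (z + j%:R - x != 0) && (z + j%:R + x != 0).
  by move=> le_jN; rewrite nz // ltnW.
transitivity ((N.+1%:R - 2 * z)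
   * (\sum_(i < N.+1) weight (2 * x) N i * (z + i%:R - x)^-1
      - \sum_(i < N.+1) weight (- (2 * x)) N i * (z + i%:R + x)^-1)
   + (3 * N.+1%:R + 2 * z)
   * (\sum_(i < N.+1) weight (2 * x) N i * (z + 1 + i%:R - x)^-1
      - \sum_(i < N.+1) weight (- (2 * x)) N i * (z + 1 + i%:R + x)^-1)).
  rewrite !mulrBr !mulr_sumr addrACA -opprD -!big_split /=.
  congr (_ - _); apply: eq_bigr => -[i lt_i] _ /=.
    have /andP[nzm _] := nz0 i lt_i; have /andP[nzm1 _] := nz1 i lt_i.
    by field; rewrite nzm nzm1.
  have /andP[_ nzm] := nz0 i lt_i; have /andP[_ nzm1] := nz1 i lt_i.
  by field; rewrite nzm nzm1.
rewrite (IH z nz0) (IH (z + 1) nz1).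
have /andP[n0m n0p] := nz 0%N isT; have /andP[nNm nNp] := nz N.+1 (leqnn _).
rewrite (big_nat_recr N.+1 1%N) // (big_nat_recr N.+1 0%N) //=.
have shift : \prod_(0 <= j < N.+1) ((z + j%:R) ^+ 2 - x ^+ 2) * ((z + N.+1%:R) ^+ 2 - x ^+ 2)
   = (z ^+ 2 - x ^+ 2) * \prod_(0 <= j < N.+1) ((z + 1 + j%:R) ^+ 2 - x ^+ 2).
  rewrite -big_nat_recr //= big_nat_recl // addr0; congr (_ * _).
  by apply: eq_bigr => j _; rewrite -nat1r addrA.
set A := \prod_(0 <= j < N.+1) ((z + j%:R) ^+ 2 - x ^+ 2) in shift *.
set B := \prod_(0 <= j < N.+1) ((z + 1 + j%:R) ^+ 2 - x ^+ 2) in shift *.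
set Q := \prod_(1 <= j < N.+1) _.
have nzA : A != 0.
  rewrite /A big_nat; elim/big_ind: _ => [|a b ha hb|j lt_j]; rewrite ?oner_eq0 ?mulf_neq0 //.
  by have /andP[a b] := nz0 j lt_j; rewrite subr_sqr mulf_neq0.
rewrite addr0 in n0m n0p.
have nz00 : z ^+ 2 - x ^+ 2 != 0 by rewrite subr_sqr mulf_neq0.
have nzN2 : (z + N.+1%:R) ^+ 2 - x ^+ 2 != 0 by rewrite subr_sqr mulf_neq0.
have -> : B = A * ((z + N.+1%:R) ^+ 2 - x ^+ 2) / (z ^+ 2 - x ^+ 2).
  by rewrite shift mulrC mulKf.
move: (N.+1%:R : R) nzN2 => M nzN2.
by field; rewrite nz00 nzN2 nzA.
Qed.

Definition shifted_harmonic (R : numFieldType) (y : R) (n : nat) : R :=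
  \sum_(1 <= k < n.+1) (k%:R + y)^-1.

(** The function Phi of the introduction. *)
Definition weighted_sum (R : numFieldType) (N : nat) (u : R) : R :=
  \sum_(i < N.+1) weight u N i * shifted_harmonic (- (u / 2)) i.

(** The truncated Bailey-Borwein-Bradley series S, which for N = oo sums to the
    series of 1/(n^2 - x^2). *)
Definition apery_sum (R : numFieldType) (N : nat) (x : R) : R :=
  \sum_(1 <= n < N.+1) 3 / 'C(2 * n, n)%:R / (n%:R ^+ 2 - x ^+ 2)
    * \prod_(1 <= m < n) ((m%:R ^+ 2 - (2 * x) ^+ 2) / (m%:R ^+ 2 - x ^+ 2)).

(** When N increases by 1, summation by parts turns the increment of the
    right-hand side into the partial fraction decomposition at z = 1, which is
    the new term of the series.  The constants produced on the way cancel
    because the sum of the weights is the same for 2x and for -2x. *)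
Lemma apery_sum_weighted (R : numFieldType) (x : R) N :
  (forall j, (0 < j <= N)%N -> (j%:R - x != 0) && (j%:R + x != 0)) ->
  2 * x * 'C(2 * N, N)%:R * apery_sum N x
  = weighted_sum N (2 * x) - weighted_sum N (- (2 * x)).
Proof.
have nz2 : 2 != 0 :> R by rewrite pnatr_eq0.
have half : 2 * x / 2 = x by rewrite mulrC mulKf.
rewrite /weighted_sum mulNr opprK half.
elim: N => [|N IH] nz.
  rewrite /apery_sum big_geq // mulr0 !big_ord1.
  by rewrite /shifted_harmonic !big_geq // !mulr0 subr0.
have nzN : N.+1%:R != 0 :> R by rewrite pnatr_eq0.
apply: (mulfI nzN).
rewrite mulrBr !weight_sum_rec.
have hS (y : R) i : shifted_harmonic y i.+1 = shifted_harmonic y i + (i.+1%:R + y)^-1.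
  by rewrite /shifted_harmonic big_nat_recr.
have nz1 j : (j <= N)%N -> (1 + j%:R - x != 0) && (1 + j%:R + x != 0).
  by move=> le_jN; rewrite nat1r nz.
have -> : \sum_(i < N.+1) weight (2 * x) N i *
     ((N.+1%:R + 2 * i%:R - 2 * x) * shifted_harmonic (- x) i
      + (3 * N%:R + 1 - 2 * i%:R + 2 * x) * shifted_harmonic (- x) i.+1)
  = (4 * N%:R + 2) * (\sum_(i < N.+1) weight (2 * x) N i * shifted_harmonic (- x) i)
    + 3 * N.+1%:R * (\sum_(i < N.+1) weight (2 * x) N i * (1 + i%:R - x)^-1)
    - 2 * \sum_(i < N.+1) weight (2 * x) N i.
  rewrite !mulr_sumr -sumrN -!big_split /=; apply: eq_bigr => -[i lt_i] _ /=.
  have /andP[nzm _] := nz1 i lt_i.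
  by rewrite hS -nat1r; field.
have -> : \sum_(i < N.+1) weight (- (2 * x)) N i *
     ((N.+1%:R + 2 * i%:R - - (2 * x)) * shifted_harmonic x i
      + (3 * N%:R + 1 - 2 * i%:R + - (2 * x)) * shifted_harmonic x i.+1)
  = (4 * N%:R + 2) * (\sum_(i < N.+1) weight (- (2 * x)) N i * shifted_harmonic x i)
    + 3 * N.+1%:R * (\sum_(i < N.+1) weight (- (2 * x)) N i * (1 + i%:R + x)^-1)
    - 2 * \sum_(i < N.+1) weight (- (2 * x)) N i.
  rewrite !mulr_sumr -sumrN -!big_split /=; apply: eq_bigr => -[i lt_i] _ /=.
  have /andP[_ nzm] := nz1 i lt_i.
  by rewrite hS -nat1r; field.
have {}IH := IH (fun j hj => nz j ltac:(lia)).
have PF := weight_partial_fractions nz1.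
rewrite !weight_sum /apery_sum big_nat_recr //=.
rewrite -/(apery_sum N x).
have Crec : N.+1%:R * 'C(2 * N.+1, N.+1)%:R = (4 * N%:R + 2) * 'C(2 * N, N)%:R :> R.
  by rewrite -natrM central_bin_rec natrM natrD natrM.
have nzC : 'C(2 * N.+1, N.+1)%:R != 0 :> R.
  by rewrite pnatr_eq0 -lt0n bin_gt0; lia.
have nzP j : (0 < j <= N.+1)%N -> j%:R ^+ 2 - x ^+ 2 != 0.
  by move=> /nz /andP[a b]; rewrite subr_sqr mulf_neq0.
set W := \sum_(i < N.+1) weight (2 * x) N i * shifted_harmonic (- x) i in IH *.
set W' := \sum_(i < N.+1) weight (- (2 * x)) N i * shifted_harmonic x i in IH *.
set V := \sum_(i < N.+1) _ in PF *; set V' := \sum_(i < N.+1) _ in PF *.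
transitivity ((4 * N%:R + 2) * (W - W') + 3 * N.+1%:R * (V - V')); last by ring.
rewrite PF -IH mulrDr.
have -> : \prod_(1 <= m < N.+1) ((m%:R ^+ 2 - (2 * x) ^+ 2) / (m%:R ^+ 2 - x ^+ 2))
   = \prod_(1 <= m < N.+1) (m%:R ^+ 2 - (2 * x) ^+ 2) / \prod_(1 <= m < N.+1) (m%:R ^+ 2 - x ^+ 2).
  by rewrite prodf_div.
have -> : \prod_(0 <= j < N.+1) ((1 + j%:R) ^+ 2 - x ^+ 2)
   = \prod_(1 <= m < N.+1) (m%:R ^+ 2 - x ^+ 2) * (N.+1%:R ^+ 2 - x ^+ 2).
  rewrite -[RHS]big_nat_recr //= big_add1 /=.
  by apply: eq_bigr => j _; rewrite nat1r.
set Q := \prod_(1 <= m < N.+1) (m%:R ^+ 2 - (2 * x) ^+ 2).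
set D := \prod_(1 <= m < N.+1) _.
have nzD : D != 0.
  rewrite /D big_nat; elim/big_ind: _ => [|a b ha hb|j lt_j]; rewrite ?oner_eq0 ?mulf_neq0 //.
  by apply: nzP; lia.
have nzL : N.+1%:R ^+ 2 - x ^+ 2 != 0 by apply: nzP; lia.
rewrite (mulrDr N.+1%:R); congr (_ + _).
  transitivity (2 * x * (N.+1%:R * 'C(2 * N.+1, N.+1)%:R) * apery_sum N x); first by ring.
  by rewrite Crec; ring.
move: (N.+1%:R : R) nzL => M nzL.
by field; rewrite nzC nzL nzD.
Qed.

(** * Rational numbers that are p-integral or divisible by a power of p *)

(** The localisation of the integers at p: denominators prime to p. *)
Definition zloc (p : nat) : {pred rat} := [pred x | coprime p `|denq x|%N].

Lemma frac_zloc p (n d : int) : coprime p `|d|%N -> n%:~R / d%:~R \in zloc p.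
Proof.
have [-> _|nz_d co_pd] := eqVneq d 0.
  by rewrite invr0 mulr0 inE coprimen1.
rewrite inE; set x : rat := _ / _; apply: coprime_dvdr co_pd.
have E : n * denq x = numq x * d.
  have nzd : d%:~R != 0 :> rat by rewrite intr_eq0.
  have nzx : (denq x)%:~R != 0 :> rat by rewrite intr_eq0 denq_neq0.
  apply: (@intr_inj rat); rewrite !intrM.
  rewrite -[n%:~R](divfK nzd) -/x -{1}[x]divq_num_den.
  by rewrite mulrAC divfK.
have : (denq x %| numq x * d)%Z by rewrite -E dvdz_mull.
by rewrite dvdzE abszM Gauss_dvdr // coprime_sym coprime_num_den.
Qed.

Lemma zloc_subring p : subring_closed (zloc p).
Proof.
have decomp (x : rat) : x = (numq x)%:~R / (denq x)%:~R by rewrite divq_num_den.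
have nzd (x : rat) : (denq x)%:~R != 0 :> rat by rewrite intr_eq0 denq_neq0.
split=> [|x y px py|x y px py]; first by rewrite inE coprimen1.
  have -> : x - y = (numq x * denq y - numq y * denq x)%:~R / (denq x * denq y)%:~R.
    rewrite {1}[x]decomp {1}[y]decomp rmorphB !rmorphM /=.
    by field; rewrite !nzd.
  by apply: frac_zloc; rewrite abszM coprimeMr; apply/andP.
have -> : x * y = (numq x * numq y)%:~R / (denq x * denq y)%:~R.
  rewrite {1}[x]decomp {1}[y]decomp !rmorphM /=.
  by field; rewrite !nzd.
by apply: frac_zloc; rewrite abszM coprimeMr; apply/andP.
Qed.

HB.instance Definition _ p := GRing.isSubringClosed.Build rat (zloc p) (zloc_subring p).

(** The fractional ideal p^r Z_(p); membership of x - y is congruence modulo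
    p^r. *)
Definition pmult (p r : nat) : {pred rat} := [pred x | x / p%:R ^+ r \in zloc p].

Lemma pmult_zmod p r : zmod_closed (pmult p r).
Proof.
split=> [|x y]; first by rewrite inE mul0r rpred0.
by rewrite ![_ \in pmult _ _]inE mulrBl; apply: rpredB.
Qed.

HB.instance Definition _ p r := GRing.isZmodClosed.Build rat (pmult p r) (pmult_zmod p r).

Lemma pmult0 p x : (x \in pmult p 0) = (x \in zloc p).
Proof. by rewrite inE expr0 divr1. Qed.

Lemma pmultM p r s x y :
  x \in pmult p r -> y \in pmult p s -> x * y \in pmult p (r + s).
Proof.
rewrite ![_ \in pmult _ _]inE => px py.
by rewrite exprD invfM mulrACA rpredM.
Qed.

Lemma pmultMl p r x y : x \in zloc p -> y \in pmult p r -> x * y \in pmult p r.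
Proof. by rewrite -pmult0 => px py; apply: (pmultM px py). Qed.

Lemma pmultMr p r x y : x \in pmult p r -> y \in zloc p -> x * y \in pmult p r.
Proof. by rewrite mulrC => px py; apply: pmultMl. Qed.

Lemma pmultX p r x n : x \in pmult p r -> x ^+ n \in pmult p (n * r).
Proof.
move=> px; elim: n => [|n IH]; first by rewrite expr0 pmult0 rpred1.
by rewrite exprS mulSn; apply: pmultM.
Qed.

Lemma pmult_self p r : (0 < p)%N -> p%:R ^+ r \in pmult p r.
Proof. by move=> p_gt0; rewrite inE divff ?rpred1 // expf_neq0 // pnatr_eq0 -lt0n. Qed.

Lemma pmult_le p r s x :
  (0 < p)%N -> (s <= r)%N -> x \in pmult p r -> x \in pmult p s.
Proof.
move=> p_gt0 le_sr; rewrite ![_ \in pmult _ _]inE => px.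
have nzp : p%:R != 0 :> rat by rewrite pnatr_eq0 -lt0n.
have -> : x / p%:R ^+ s = x / p%:R ^+ r * p%:R ^+ (r - s).
  rewrite -{1}(subnKC le_sr) exprD; field.
  by rewrite !expf_neq0.
by rewrite rpredM // rpredX // rpred_nat.
Qed.

Lemma pmult_zloc p r x : (0 < p)%N -> x \in pmult p r -> x \in zloc p.
Proof. by move=> p0 /(pmult_le p0 (leq0n r)); rewrite pmult0. Qed.

Lemma inv_zloc p n : coprime p n -> n%:R^-1 \in zloc p.
Proof. by move=> co; rewrite -[_^-1]mul1r; apply: (@frac_zloc p 1 n). Qed.

Lemma pmult_divp p r x : (0 < p)%N -> p%:R * x \in pmult p r.+1 -> x \in pmult p r.
Proof.
move=> p_gt0; rewrite ![_ \in pmult _ _]inE.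
by rewrite exprS invfM mulrACA divff ?mul1r // pnatr_eq0 -lt0n.
Qed.

Lemma pmult_cancel p r n x :
  coprime p n -> (0 < n)%N -> n%:R * x \in pmult p r -> x \in pmult p r.
Proof.
move=> co n_gt0 px; rewrite -[x](mulKf (_ : n%:R != 0)) ?pnatr_eq0 -?lt0n //.
by apply: pmultMl px; apply: inv_zloc.
Qed.

Lemma dvdn_pmult1 p n : (p %| n)%N -> (n%:R : rat) \in pmult p 1.
Proof.
case/dvdnP=> q ->; rewrite inE expr1 natrM.
have [->|nzp] := eqVneq p 0%N; first by rewrite invr0 mulr0 rpred0.
by rewrite mulfK ?pnatr_eq0 // rpred_nat.
Qed.

Lemma mem_eq (T : Type) (S : {pred T}) x y : x \in S -> x = y -> y \in S.
Proof. by move=> Sx <-. Qed.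

Lemma sign_zloc p n : (-1) ^+ n \in zloc p.
Proof. by rewrite rpredX // rpredN rpred1. Qed.

Ltac zloc_closed :=
  repeat match goal with
  | H : is_true (?x \in _) |- is_true (?x \in _) => exact: H
  | |- is_true (0 \in _) => exact: rpred0
  | |- is_true (1 \in _) => exact: rpred1
  | |- is_true (_%:R \in _) => exact: rpred_nat
  | |- is_true ((-1) ^+ _ \in _) => exact: sign_zloc
  | |- is_true (_ ^+ _ \in _) => apply: rpredX
  | |- is_true (- _ \in _) => rewrite rpredN
  | |- is_true (_ + _ \in _) => apply: rpredD
  | |- is_true (_ * _ \in _) => apply: rpredM
  end.

Lemma coprime_lt p k : prime p -> (0 < k < p)%N -> coprime p k.
Proof.
move=> p_pr /andP[k0 kp]; rewrite prime_coprime //.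
by apply/negP => /(dvdn_leq k0); rewrite leqNgt kp.
Qed.

Lemma inv_sub_zloc p k y :
  prime p -> (0 < k < p)%N -> y \in pmult p 1 -> (k%:R - y)^-1 \in zloc p.
Proof.
move=> p_pr k_lt; rewrite inE expr1; set z := y / _ => pz.
have nzp : p%:R != 0 :> rat by rewrite pnatr_eq0 -lt0n prime_gt0.
have nzd : (denq z)%:~R != 0 :> rat by rewrite intr_eq0 denq_neq0.
have -> : (k%:R - y)^-1 = (denq z)%:~R / (k%:Z * denq z - p%:Z * numq z)%:~R.
  have -> : y = p%:R * ((numq z)%:~R / (denq z)%:~R).
    by rewrite divq_num_den /z mulrCA divff ?mulr1.
  rewrite rmorphB !rmorphM /= -[RHS]invf_div; congr (_^-1).
  by field.
apply: frac_zloc; rewrite prime_coprime //; apply/negP => dv.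
have {}dv : (p%:Z %| k%:Z * denq z - p%:Z * numq z)%Z by [].
have : (p%:Z %| k%:Z * denq z)%Z.
  by rewrite -[_ * _](subrK (p%:Z * numq z)) rpredD // dvdz_mulr.
rewrite dvdzE abszM /= Euclid_dvdM //.
have := coprime_lt p_pr k_lt; rewrite prime_coprime // => /negPf ->.
by move: pz; rewrite inE prime_coprime // => /negPf ->.
Qed.

Lemma zloc_pmult1_ratcong p x :
  prime p -> x \in pmult p 1 -> ratcong p 1 x 0.
Proof.
move=> p_pr; have [->|nzx] := eqVneq x 0; first by left.
rewrite inE expr1; set z := x / _ => pz; right; rewrite subr0 /padic_val.
have nzp : p%:R != 0 :> rat by rewrite pnatr_eq0 -lt0n prime_gt0.
have E : numq x * denq z = p%:Z * numq z * denq x.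
  apply: (@intr_inj rat); rewrite !rmorphM /=.
  have nzd (y : rat) : (denq y)%:~R != 0 :> rat by rewrite intr_eq0 denq_neq0.
  have H : x = p%:R * z by rewrite /z mulrCA divff ?mulr1.
  have := H; rewrite -{1}[x]divq_num_den -{1}[z]divq_num_den => H'.
  apply: (mulIf (invr_neq0 (mulf_neq0 (nzd x) (nzd z)))).
  transitivity ((numq x)%:~R / (denq x)%:~R : rat); first by field; rewrite !nzd.
  by rewrite H'; field; rewrite !nzd.
have pn : (p %| `|numq x|)%N.
  have : (p %| `|(numq x * denq z)%R|)%N by rewrite E -mulrA abszM dvdn_mulr.
  by rewrite abszM Gauss_dvdl.
have pd : logn p `|denq x| = 0%N.
  apply: logn_coprime; apply: coprime_dvdl pn _; exact: coprime_num_den.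
rewrite pd subr0 lez_nat.
by rewrite -pfactor_dvdn ?expn1 // absz_gt0 numq_eq0.
Qed.

Lemma one_notin_pmult p : prime p -> 1 \notin pmult p 1.
Proof.
move=> p_pr; have p_gt1 := prime_gt1 p_pr; apply/negP.
rewrite inE expr1 inE -[p%:R]/(p%:Z%:~R) -[1]/(1%:~R).
rewrite coprimeq_den ?coprime1n //; case: eqP => [|_]; first by lia.
by rewrite absz_id absz_nat /coprime gcdnn; apply/negP; lia.
Qed.

Lemma sub_pmult_neq0 p k y :
  prime p -> (0 < k < p)%N -> y \in pmult p 1 -> k%:R - y != 0.
Proof.
move=> p_pr lt_k py; apply: contraNneq (one_notin_pmult p_pr) => E.
have nzk : k%:R != 0 :> rat by rewrite pnatr_eq0; lia.
rewrite -(mulVf nzk) (subr0_eq E) in py *.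
by rewrite pmultMl // -(subr0_eq E) inv_zloc // coprime_lt.
Qed.

(** No multiple of p^2, and at most one multiple of p, is among 1, ..., 2k when
    k < p. *)
Lemma logn_central_bin p k : prime p -> (k < p)%N -> (logn p 'C(2 * k, k) <= 1)%N.
Proof.
move=> p_pr lt_kp; have p_gt1 := prime_gt1 p_pr.
apply: (@leq_trans (logn p (2 * k)`!)).
  apply: dvdn_leq_log; rewrite ?fact_gt0 //.
  have le_k : (k <= 2 * k)%N by lia.
  by rewrite -(bin_fact le_k) dvdn_mulr.
rewrite logn_fact //; case: k lt_kp => [|k] lt_kp; first by rewrite big_geq.
rewrite big_ltn; last by lia.
rewrite big_nat big1 => [|j /andP[j_gt1 _]].
  by rewrite addn0 expn1 -ltnS ltn_divLR; lia.
apply: divn_small; apply: (@leq_trans (p ^ 2)); last by rewrite leq_exp2l.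
by rewrite expnS expn1; nia.
Qed.

Lemma central_bin_zloc p k :
  prime p -> (k < p)%N -> p%:R / 'C(2 * k, k)%:R \in zloc p.
Proof.
move=> p_pr lt_kp; have p_gt0 := prime_gt0 p_pr.
have nzp : p%:R != 0 :> rat by rewrite pnatr_eq0 -lt0n.
have C_gt0 : (0 < 'C(2 * k, k))%N by rewrite bin_gt0; lia.
have [m co_pm ->] := pfactor_coprime p_pr C_gt0.
have := logn_central_bin p_pr lt_kp; case: (logn _ _) => [|[|//]] _.
  by rewrite muln1; apply: rpredM; rewrite ?rpred_nat ?inv_zloc.
rewrite expn1 natrM invfM mulrCA divff // mulr1; exact: inv_zloc.
Qed.

Lemma inv_sqr_sub_zloc p k x :
  prime p -> (0 < k < p)%N -> x \in pmult p 1 -> (k%:R ^+ 2 - x ^+ 2)^-1 \in zloc p.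
Proof.
move=> p_pr lt_k px; rewrite subr_sqr invfM.
apply: rpredM; first exact: inv_sub_zloc.
by rewrite -[x]opprK; apply: inv_sub_zloc; rewrite ?rpredN.
Qed.

Lemma sqr_sub_neq0 p k x :
  prime p -> (0 < k < p)%N -> x \in pmult p 1 -> k%:R ^+ 2 - x ^+ 2 != 0.
Proof.
move=> p_pr lt_k px; rewrite subr_sqr mulf_neq0 //.
  exact: sub_pmult_neq0 px.
by rewrite -[x]opprK; apply: (sub_pmult_neq0 p_pr lt_k); rewrite rpredN.
Qed.

(** * Harmonic numbers modulo p and modulo the square of p *)

(** Pascal's recurrence for power sums: telescoping (k+1)^(e+1) - k^(e+1) gives
    e + 1 times the sum as p^(e+1) minus multiples of the lower power sums. *)
Lemma dvdn_power_sum p e :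
  prime p -> (e < p.-1)%N -> (p %| \sum_(0 <= k < p) k ^ e)%N.
Proof.
move=> p_pr; have [n] := ubnP e; elim: n e => // n IH e; rewrite ltnS => le_en lt_ep.
(* Both sides of the telescoping identity are completed by the power sum of
   exponent e + 1, which then cancels. *)
have tele : (\sum_(i < e.+1) 'C(e.+1, i) * \sum_(0 <= k < p) k ^ i = p ^ e.+1)%N.
  apply: (@addnI (\sum_(0 <= k < p) k ^ e.+1)%N).
  transitivity (\sum_(0 <= k < p) k.+1 ^ e.+1)%N; last first.
    transitivity (\sum_(1 <= k < p.+1) k ^ e.+1)%N; first by rewrite big_add1.
    by rewrite -[RHS]big_nat_recr //= [RHS]big_ltn // exp0n.
  under [RHS]eq_bigr => k _.
    rewrite -addn1 addnC expnDn.
    under eq_bigr do rewrite exp1n mul1n.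
    rewrite big_ord_recr /= binn mul1n addnC.
    over.
  rewrite big_split /=; congr (_ + _)%N.
  by rewrite exchange_big; apply: eq_bigr => i _; rewrite big_distrr.
move: tele; rewrite big_ord_recr /= => tele.
have dv : (p %| \sum_(i < e) 'C(e.+1, i) * \sum_(0 <= k < p) k ^ i)%N.
  apply: dvdn_sum => -[i lt_ie] _ /=; apply: dvdn_mull; apply: IH; lia.
have : (p %| p ^ e.+1)%N by rewrite dvdn_exp.
rewrite -tele dvdn_addr // Gauss_dvdr // binSn coprime_lt //; lia.
Qed.

Lemma harmonicS n a : harmonic n.+1 a = harmonic n a + 1 / n.+1%:R ^+ a.
Proof. by rewrite /harmonic big_nat_recr. Qed.

Lemma harmonic0 a : harmonic 0 a = 0.
Proof. by rewrite /harmonic big_geq. Qed.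

Lemma pow_inv_zloc p k a :
  prime p -> (0 < k < p)%N -> 1 / k%:R ^+ a \in zloc p.
Proof.
by move=> p_pr lt_k; rewrite div1r -exprVn rpredX // inv_zloc // coprime_lt.
Qed.

Lemma harmonic_zloc p n a : prime p -> (n < p)%N -> harmonic n a \in zloc p.
Proof.
move=> p_pr lt_np; rewrite /harmonic big_nat rpred_sum // => k lt_k.
apply: pow_inv_zloc => //; lia.
Qed.

(** By Fermat 1/k^a is congruent to k^(p-1-a), so this is a power sum. *)
Lemma harmonic_pmult1 p a :
  prime p -> (0 < a < p.-1)%N -> harmonic p.-1 a \in pmult p 1.
Proof.
move=> p_pr /andP[a_gt0 lt_ap]; have p_gt0 := prime_gt0 p_pr.
have S0 : (\sum_(0 <= k < p) k ^ (p.-1 - a))%:R \in pmult p 1.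
  by apply: dvdn_pmult1; apply: dvdn_power_sum => //; lia.
rewrite -(rpredBr _ S0) /harmonic prednK // natr_sum.
rewrite [X in _ - X]big_ltn // exp0n ?subn_gt0 // add0r -sumrB big_nat.
apply: rpred_sum => k lt_kp.
have nzk : k%:R != 0 :> rat by rewrite pnatr_eq0; lia.
have E : 1 / k%:R ^+ a - (k ^ (p.-1 - a))%:R
         = - (1 / k%:R ^+ a * (k ^ p.-1 - 1)%:R) :> rat.
  rewrite natrB ?expn_gt0; last by lia.
  rewrite -{2}(subnK (ltnW lt_ap)) expnD natrM !natrX; field.
  by rewrite expf_neq0.
rewrite E rpredN; apply: pmultMl; first exact: pow_inv_zloc.
apply: dvdn_pmult1; rewrite -(Gauss_dvdr _ (coprime_lt p_pr lt_kp)) mulnBr muln1.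
rewrite -expnS prednK // -eqn_mod_dvd; last first.
  by rewrite -{1}(expn1 k) leq_pexp2l //; lia.
by apply/eqP; apply: fermat_little.
Qed.

(** The first two terms of the expansion of (p - k)^(-a) in powers of p. *)
Lemma pow_inv_reflect p k a :
  prime p -> (0 < k < p)%N ->
  1 / (p - k)%:R ^+ a
    - (-1) ^+ a * (1 / k%:R ^+ a + p%:R * (a%:R * (1 / k%:R ^+ a.+1)))
    \in pmult p 2.
Proof.
move=> p_pr lt_k; have p_gt0 := prime_gt0 p_pr.
have nzk : k%:R != 0 :> rat by rewrite pnatr_eq0; lia.
have nzpk : (p - k)%:R != 0 :> rat by rewrite pnatr_eq0; lia.
have lt_pk : (0 < p - k < p)%N by lia.
set y : rat := k%:R^-1; set v : rat := (p - k)%:R^-1.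
have Yz : y \in zloc p by rewrite inv_zloc // coprime_lt.
have Vz : v \in zloc p by rewrite inv_zloc // coprime_lt.
have Ev : v = - y - p%:R * y ^+ 2 + p%:R ^+ 2 * (y ^+ 2 * v).
  have Ep : p%:R = (p - k)%:R + k%:R :> rat by rewrite -natrD subnK //; lia.
  by rewrite /v /y Ep; field; rewrite nzk nzpk.
rewrite !div1r -!exprVn -/y -/v.
elim: a => [|a IH]; first by rewrite !expr0 mul0r mulr0 addr0 mulr1 subrr rpred0.
have -> : v ^+ a.+1 - (-1) ^+ a.+1 * (y ^+ a.+1 + p%:R * (a.+1%:R * y ^+ a.+2))
  = v * (v ^+ a - (-1) ^+ a * (y ^+ a + p%:R * (a%:R * y ^+ a.+1)))
   + p%:R ^+ 2 * ((-1) ^+ a * y ^+ a.+2 * (v * (1 + a%:R * p%:R * y) - a%:R * y)).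
  rewrite -nat1r mulrBr -exprS; rewrite [in v * ((-1) ^+ a * _)]Ev.
  rewrite !exprS; ring.
rewrite rpredD //; first exact: pmultMl.
apply: pmultMr; first exact: pmult_self.
zloc_closed.
Qed.

Lemma pow_inv_reflect1 p k a :
  prime p -> (0 < k < p)%N ->
  1 / (p - k)%:R ^+ a - (-1) ^+ a * (1 / k%:R ^+ a) \in pmult p 1.
Proof.
move=> p_pr lt_k; have p_gt0 := prime_gt0 p_pr.
have /(pmult_le p_gt0 (isT : 1 <= 2)%N) := pow_inv_reflect a p_pr lt_k.
rewrite mulrDr opprD addrA rpredBr // mulrCA; apply: pmultMr.
  exact: (pmult_self 1).
by have Z := pow_inv_zloc a.+1 p_pr lt_k; zloc_closed.
Qed.

(** Reflecting k to p - k shows that 2 H(a) is -a p H(a+1) modulo p^2 for odd a,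
    and p divides H(a+1). *)
Lemma harmonic_pmult2 p a :
  prime p -> odd a -> (a.+1 < p.-1)%N -> harmonic p.-1 a \in pmult p 2.
Proof.
move=> p_pr odd_a lt_ap; have p_gt0 := prime_gt0 p_pr.
apply: (@pmult_cancel _ _ 2) => //; first by rewrite coprime_lt //; lia.
have E : harmonic p.-1 a = \sum_(1 <= k < p) 1 / (p - k)%:R ^+ a.
  rewrite /harmonic prednK // big_nat_rev /=.
  by apply: eq_bigr => k _; rewrite add1n subSS.
have H : harmonic p.-1 a - - (harmonic p.-1 a + p%:R * (a%:R * harmonic p.-1 a.+1))
    \in pmult p 2.
  rewrite {1}E /harmonic prednK // !mulr_sumr -big_split -sumrN -sumrB big_nat.
  apply: rpred_sum => k lt_k; have := pow_inv_reflect a p_pr lt_k.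
  by rewrite -signr_odd odd_a expr1 mulN1r.
have H' : p%:R * (a%:R * harmonic p.-1 a.+1) \in pmult p 2.
  apply: (@pmultM p 1 1); first exact: (pmult_self 1 p_gt0).
  by apply: pmultMl; rewrite ?rpred_nat // harmonic_pmult1 //; lia.
by apply: mem_eq (rpredB H H') _; ring.
Qed.

Lemma sum_harmonic n a :
  \sum_(i < n.+1) harmonic i a.+1 = n.+1%:R * harmonic n a.+1 - harmonic n a.
Proof.
elim: n => [|n IH]; first by rewrite big_ord1 !harmonic0; ring.
have nz : n.+1%:R != 0 :> rat by rewrite pnatr_eq0.
rewrite big_ord_recr IH !harmonicS /= exprS -[n.+2%:R]nat1r; field.
by rewrite expf_neq0 // nat1r.
Qed.

Lemma harmonic_reflect p a i :
  prime p -> (0 < a < p.-1)%N -> (i < p)%N ->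
  harmonic (p.-1 - i) a + (-1) ^+ a * harmonic i a \in pmult p 1.
Proof.
move=> p_pr lt_a; elim: i => [|i IH] lt_ip.
  by rewrite subn0 harmonic0 mulr0 addr0 harmonic_pmult1.
have := IH (ltnW lt_ip).
have -> : (p.-1 - i = (p.-1 - i.+1).+1)%N by lia.
rewrite !harmonicS; have -> : ((p.-1 - i.+1).+1 = p - i.+1)%N by lia.
have R : _ \in _ := @pow_inv_reflect1 p i.+1 a p_pr lt_ip.
by move=> H; apply: mem_eq (rpredB H R) _; ring.
Qed.

(** Under i -> p - 1 - i each factor is multiplied by a sign modulo p, and
    the product of the two signs is -1 since a + b is odd. *)
Lemma sum_harmonicM p a b :
  prime p -> (0 < a < p.-1)%N -> (0 < b < p.-1)%N -> odd (a + b) ->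
  \sum_(i < p) harmonic i a * harmonic i b \in pmult p 1.
Proof.
move=> p_pr lt_a lt_b odd_ab.
apply: (@pmult_cancel _ _ 2) => //; first by rewrite coprime_lt //; lia.
rewrite mulr2n mulrDl mul1r {1}(reindex_inj rev_ord_inj) -big_split /=.
apply: rpred_sum => -[i lt_i] _ /=.
have -> : (p - i.+1 = p.-1 - i)%N by lia.
have Ha := harmonic_reflect p_pr lt_a lt_i.
have Hb := harmonic_reflect p_pr lt_b lt_i.
have za : (-1) ^+ a * harmonic i a \in zloc p.
  zloc_closed; exact: harmonic_zloc.
have zb : harmonic (p.-1 - i) b \in zloc p by rewrite harmonic_zloc //; lia.
have S : (-1) ^+ a * (-1) ^+ b = -1 :> rat.
  by rewrite -exprD -signr_odd odd_ab expr1.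
apply: mem_eq (rpredB (pmultMr Ha zb) (pmultMl za Hb)) _.
transitivity (harmonic (p.-1 - i) a * harmonic (p.-1 - i) b
   - ((-1) ^+ a * (-1) ^+ b) * (harmonic i a * harmonic i b)); first by ring.
by rewrite S; ring.
Qed.

(** * Polynomial approximation on multiples of p *)

Lemma polyOver_pmultM p r (f g : {poly rat}) :
  f \is a polyOver (zloc p) -> g \is a polyOver (pmult p r) ->
  f * g \is a polyOver (pmult p r).
Proof.
move=> /polyOverP pf /polyOverP pg; apply/polyOverP => m.
by rewrite coefM rpred_sum // => i _; apply: pmultMl.
Qed.

(** The functions in play are rational, with p-integral Taylor coefficients at 0;
    a polynomial that gives their values modulo p^5 on all multiples of p is
    enough of that expansion, and this relation is stable under sums and
    products. *)
Definition approx (p : nat) (f : rat -> rat) (g : {poly rat}) : Prop :=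
  g \is a polyOver (zloc p)
  /\ forall u, u \in pmult p 1 -> f u - g.[u] \in pmult p 5.

Lemma approx_polyOver p f g : approx p f g -> g \is a polyOver (zloc p).
Proof. by case. Qed.

Lemma approx_ext p f f' g :
  (forall u, u \in pmult p 1 -> f u = f' u) -> approx p f g -> approx p f' g.
Proof. by move=> E [pg H]; split=> // u pu; rewrite -E // H. Qed.

Lemma approx_poly p (g : {poly rat}) :
  g \is a polyOver (zloc p) -> approx p (horner g) g.
Proof. by move=> pg; split=> // u _; rewrite subrr rpred0. Qed.

Lemma approxD p f f' g g' :
  approx p f g -> approx p f' g' -> approx p (fun u => f u + f' u) (g + g').
Proof.
move=> [pg H] [pg' H']; split=> [|u pu]; first exact: rpredD.
by rewrite hornerD opprD addrACA rpredD ?H ?H'.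
Qed.

Lemma approxM p f f' g g' : (0 < p)%N ->
  approx p f g -> approx p f' g' -> approx p (fun u => f u * f' u) (g * g').
Proof.
move=> p_gt0 [pg H] [pg' H']; split=> [|u pu]; first exact: rpredM.
have zu := pmult_zloc p_gt0 pu.
have zg := rpred_horner pg zu; have zg' := rpred_horner pg' zu.
have -> : f u * f' u - (g * g').[u]
  = (f u - g.[u]) * (f' u - g'.[u]) + (f u - g.[u]) * g'.[u] + g.[u] * (f' u - g'.[u]).
  by rewrite hornerM; ring.
rewrite !rpredD //.
- by rewrite pmultMr ?H // (pmult_zloc p_gt0 (H' u pu)).
- by rewrite pmultMr ?H.
- by rewrite pmultMl ?H'.
Qed.

Lemma approx_sum p m n (f : nat -> rat -> rat) (g : nat -> {poly rat}) :
  (forall i, (m <= i < n)%N -> approx p (f i) (g i)) ->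
  approx p (fun u => \sum_(m <= i < n) f i u) (\sum_(m <= i < n) g i).
Proof.
move=> H; split=> [|u pu].
  by rewrite big_nat rpred_sum // => i /H[].
rewrite horner_sum -sumrB big_nat rpred_sum // => i /H[_]; exact.
Qed.

Lemma approx_prod p m n (f : nat -> rat -> rat) (g : nat -> {poly rat}) :
  (0 < p)%N -> (forall i, (m <= i < n)%N -> approx p (f i) (g i)) ->
  approx p (fun u => \prod_(m <= i < n) f i u) (\prod_(m <= i < n) g i).
Proof.
move=> p_gt0; elim: n => [|n IH] H.
  rewrite big_geq //; apply: approx_ext (approx_poly (rpred1 _)) => u _.
  by rewrite hornerC big_geq.
have [le_mn|lt_nm] := leqP m n; last first.
  rewrite big_geq //; apply: approx_ext (approx_poly (rpred1 _)) => u _.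
  by rewrite hornerC big_geq.
rewrite big_nat_recr //=.
have A := approxM p_gt0 (IH (fun i hi => H i ltac:(lia))) (H n ltac:(lia)).
by apply: approx_ext A => u _; rewrite big_nat_recr.
Qed.

(** The Taylor polynomial of 1/(j - cu); five terms, because u^5 is
    negligible modulo p^5. *)
Definition geo (c : rat) (j : nat) : {poly rat} :=
  \poly_(m < 5) (c ^+ m / j%:R ^+ m.+1).

Lemma approx_geo p c j :
  prime p -> c \in zloc p -> (0 < j < p)%N ->
  approx p (fun u => (j%:R - c * u)^-1) (geo c j).
Proof.
move=> p_pr zc lt_j; have p_gt0 := prime_gt0 p_pr.
have zj : j%:R^-1 \in zloc p by rewrite inv_zloc // coprime_lt.
split=> [|u pu].
  apply/polyOverP => m; rewrite coef_poly; case: ifP => _; last exact: rpred0.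
  by rewrite -exprVn; zloc_closed.
have py : c * u \in pmult p 1 by apply: pmultMl.
have nzj : j%:R != 0 :> rat by rewrite pnatr_eq0; lia.
have nzjy := sub_pmult_neq0 p_pr lt_j py.
have zjy := inv_sub_zloc p_pr lt_j py.
have -> : (j%:R - c * u)^-1 - (geo c j).[u]
  = (c * u) ^+ 5 * (j%:R^-1 ^+ 5 * (j%:R - c * u)^-1).
  by rewrite horner_poly !big_ord_recl big_ord0 /=; field; rewrite nzj nzjy.
apply: pmultMr; first exact: (pmultX 5 py).
by zloc_closed.
Qed.

(** In g(u) - g(-u) the even powers cancel, those beyond the fourth are
    negligible, and so is the cubic one by the assumption on its coefficient. *)
Lemma approx_odd_part p f g u :
  (0 < p)%N -> approx p f g -> g`_3 \in pmult p 2 -> u \in pmult p 1 ->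
  f u - f (- u) - 2 * g`_1 * u \in pmult p 5.
Proof.
move=> p_gt0 [pg H] g3 pu.
have pu' : - u \in pmult p 1 by rewrite rpredN.
suff G : g.[u] - g.[- u] - 2 * g`_1 * u \in pmult p 5.
  by apply: mem_eq (rpredD (rpredB (H u pu) (H _ pu')) G) _; ring.
(* At least two terms, so that the linear one can be extracted. *)
pose n := maxn 2 (size g).
have lt1n : (1 < n)%N by rewrite leq_max.
rewrite !(@horner_coef_wide _ n) ?leq_maxr // -sumrB (bigD1 (Ordinal lt1n)) //=.
set S := \sum_(i < n | _) _.
apply: (@mem_eq _ _ S); last by rewrite !expr1; ring.
apply: rpred_sum => -[[|[|m]] lt_m] //= _; first by rewrite !expr0 subrr rpred0.
rewrite [X in _ * _ - _ * X]exprNn.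
have -> : g`_(m.+2) * u ^+ m.+2 - g`_(m.+2) * ((-1) ^+ m.+2 * u ^+ m.+2)
  = (1 - (-1) ^+ m.+2) * (g`_(m.+2) * u ^+ m.+2) by ring.
have gz k : g`_k \in zloc p by apply/polyOverP.
case: m lt_m => [|[|[|m]]] lt_m.
- by rewrite sqrrN expr1n subrr mul0r rpred0.
- apply: pmultMl; first by zloc_closed.
  exact: (pmultM g3 (pmultX 3 pu)).
- by rewrite -signr_odd /= expr0 subrr mul0r rpred0.
- do 2![apply: pmultMl; first by zloc_closed].
  by apply: (pmult_le p_gt0 _ (pmultX m.+4.+1 pu)); rewrite muln1.
Qed.

(** * The cubic coefficient of the approximating polynomial *)

(** Approximations of the factors of the weights for N = p - 1: the product
    over all j < p, which is common to them, and the one over j <= i. *)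
Definition weight_scale (p : nat) : {poly rat} :=
  \prod_(1 <= j < p) (1 - j%:R^-1 *: 'X).

Definition weight_tail (p i : nat) : {poly rat} :=
  \prod_(1 <= j < i.+1) ((1 - p%:R * (j%:R^-1)%:P) * (1 - p%:R * geo 1 j)).

Definition harmonic_poly (c : rat) (i : nat) : {poly rat} :=
  \sum_(1 <= j < i.+1) geo c j.

Definition weighted_poly (p : nat) : {poly rat} :=
  \sum_(0 <= i < p) weight_scale p * weight_tail p i * harmonic_poly 2^-1 i.

Lemma approx_weighted_sum p :
  prime p -> (2 < p)%N -> approx p (weighted_sum p.-1) (weighted_poly p).
Proof.
move=> p_pr p_gt2; have p_gt0 := prime_gt0 p_pr.
have z2 : 2^-1 \in zloc p by rewrite inv_zloc // coprime_lt.
have zp : p%:R \is a polyOver (zloc p) by rewrite rpred_nat.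
have zj j : (0 < j < p)%N -> j%:R^-1 \in zloc p by move=> lt_j; rewrite inv_zloc ?coprime_lt.
have As : approx p (fun u => \prod_(1 <= j < p) (1 - u / j%:R)) (weight_scale p).
  apply: approx_prod => // j lt_j.
  have P : 1 - j%:R^-1 *: 'X \is a polyOver (zloc p).
    by rewrite rpredB ?rpred1 // polyOverZ ?polyOverX ?zj.
  apply: approx_ext (approx_poly P) => u _.
  by rewrite hornerD hornerN hornerZ hornerX hornerC mulrC.
have Cp : approx p (fun=> p%:R) p%:R.
  by apply: approx_ext (approx_poly zp) => u _; rewrite hornerMn hornerC.
have At i : (i < p)%N -> approx p (fun u => \prod_(1 <= j < i.+1)
    ((1 - p%:R / j%:R) * (1 - p%:R / (j%:R - u)))) (weight_tail p i).
  move=> lt_i; apply: approx_prod => // j lt_j.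
  have lt_jp : (0 < j < p)%N by lia.
  have Pj : 1 - p%:R * (j%:R^-1)%:P \is a polyOver (zloc p).
    by rewrite rpredB ?rpred1 // rpredM // polyOverC zj.
  have Pm : (-1) \is a polyOver (zloc p) by rewrite rpredN rpred1.
  have P1 : 1 \is a polyOver (zloc p) by rewrite rpred1.
  have A1 := approx_geo p_pr (rpred1 (zloc p)) lt_jp.
  have A := approxM p_gt0 (approx_poly Pj)
    (approxD (approx_poly P1) (approxM p_gt0 (approx_poly Pm) (approxM p_gt0 Cp A1))).
  rewrite mulN1r in A.
  apply: approx_ext A => u _ /=.
  by rewrite !(hornerD, hornerN, hornerM, hornerC, hornerMn) mul1r mulN1r.
have Ah i : (i < p)%N ->
    approx p (fun u => shifted_harmonic (- (u / 2)) i) (harmonic_poly 2^-1 i).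
  move=> lt_i; apply: approx_sum => j lt_j.
  have lt_jp : (0 < j < p)%N by lia.
  by apply: approx_ext (approx_geo p_pr z2 lt_jp) => u _; rewrite [2^-1 * u]mulrC.
have A : approx p (fun u => \sum_(0 <= i < p)
      \prod_(1 <= j < p) (1 - u / j%:R)
      * \prod_(1 <= j < i.+1) ((1 - p%:R / j%:R) * (1 - p%:R / (j%:R - u)))
      * shifted_harmonic (- (u / 2)) i) (weighted_poly p).
  apply: approx_sum => i lt_i.
  apply: (approxM p_gt0 (approxM p_gt0 As (At i ltac:(lia))) (Ah i ltac:(lia))).
apply: approx_ext A => u pu.
rewrite /weighted_sum prednK // big_mkord; apply: eq_bigr => -[i lt_i] _ /=.
rewrite weight_pred // => j lt_j.
exact: (sub_pmult_neq0 p_pr lt_j pu).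
Qed.

(** Newton's identities for the elementary symmetric functions of 1, 1/2, ...,
    1/n, up to sign. *)
Lemma coef_scale_harmonic n (Q := \prod_(1 <= j < n.+1) (1 - j%:R^-1 *: 'X) : {poly rat}) :
  [/\ Q`_0 = 1, Q`_1 = - harmonic n 1,
      2 * Q`_2 = harmonic n 1 ^+ 2 - harmonic n 2
    & 6 * Q`_3 = - (harmonic n 1 ^+ 3 - 3 * harmonic n 1 * harmonic n 2
                     + 2 * harmonic n 3)].
Proof.
rewrite {}/Q; elim: n => [|n]; first by rewrite big_geq // !harmonic0 !coefC /=; split; ring.
rewrite !harmonicS (big_nat_recr n.+1) //=; set Q := \prod_(1 <= j < n.+1) _.
have nz : n.+1%:R != 0 :> rat by rewrite pnatr_eq0.
set y : rat := n.+1%:R^-1.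
have cS m : (Q * (1 - y *: 'X))`_m.+1 = Q`_m.+1 - y * Q`_m.
  by rewrite mulrBr mulr1 -scalerAr coefB coefZ coefMX.
have c0 : (Q * (1 - y *: 'X))`_0 = Q`_0.
  by rewrite mulrBr mulr1 -scalerAr coefB coefZ coefMX mulr0 subr0.
rewrite !cS c0 !div1r -!exprVn -/y.
case=> q0 q1 q2 q3; split=> //.
- by rewrite q1 q0; ring.
- transitivity (2 * Q`_2 - 2 * y * Q`_1); first by ring.
  by rewrite q2 q1; ring.
- transitivity (6 * Q`_3 - 3 * y * (2 * Q`_2)); first by ring.
  by rewrite q3 q2; ring.
Qed.

Lemma coef_harmonic_poly c i m :
  (m < 5)%N -> (harmonic_poly c i)`_m = c ^+ m * harmonic i m.+1.
Proof.
move=> lt_m; rewrite /harmonic_poly /harmonic coef_sum mulr_sumr.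
by apply: eq_bigr => j _; rewrite coef_poly lt_m div1r.
Qed.

Lemma coefM1 (R : nzRingType) (f g : {poly R}) :
  (f * g)`_1 = f`_0 * g`_1 + f`_1 * g`_0.
Proof. by rewrite coefM !big_ord_recl big_ord0 addr0. Qed.

Lemma coefM3 (R : nzRingType) (f g : {poly R}) :
  (f * g)`_3 = f`_0 * g`_3 + f`_1 * g`_2 + f`_2 * g`_1 + f`_3 * g`_0.
Proof. by rewrite coefM !big_ord_recl big_ord0 addr0 !addrA. Qed.

Lemma harmonic_poly_over p c i :
  prime p -> c \in zloc p -> (i < p)%N -> harmonic_poly c i \is a polyOver (zloc p).
Proof.
move=> p_pr zc lt_i; rewrite /harmonic_poly big_nat rpred_sum // => j lt_j.
by apply: approx_polyOver (approx_geo p_pr zc _); lia.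
Qed.

(** Each factor of the tail is 1 modulo p, so modulo p^2 the product is 1 plus
    the sum of the deviations. *)
Lemma weight_tail_linear p i :
  prime p -> (i < p)%N ->
  weight_tail p i - (1 - p%:R * ((harmonic i 1)%:P + harmonic_poly 1 i))
    \is a polyOver (pmult p 2).
Proof.
move=> p_pr; have p_gt0 := prime_gt0 p_pr.
elim: i => [|i IH] lt_i.
  rewrite /weight_tail /harmonic_poly !big_geq // harmonic0.
  by rewrite polyC0 addr0 mulr0 subr0 subrr rpred0.
have lt_ip : (0 < i.+1 < p)%N by lia.
have {}IH := IH (ltnW lt_i).
have Ha : (i.+1%:R^-1)%:P \is a polyOver (zloc p).
  by rewrite polyOverC inv_zloc // coprime_lt.
have Hk := approx_polyOver (approx_geo p_pr (rpred1 (zloc p)) lt_ip).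
have Hh := harmonic_poly_over p_pr (rpred1 (zloc p)) (ltnW lt_i).
have HH : (harmonic i 1)%:P \is a polyOver (zloc p).
  by rewrite polyOverC harmonic_zloc // ltnW.
have Hp2 : p%:R ^+ 2 \is a polyOver (pmult p 2).
  by rewrite -[p%:R]polyC_natr -polyC_exp polyOverC; apply: pmult_self.
rewrite /weight_tail big_nat_recr //= -/(weight_tail p i).
rewrite /harmonic_poly big_nat_recr //= -/(harmonic_poly 1 i) harmonicS polyCD expr1 div1r.
set T := weight_tail p i in IH *; set a := _%:P in Ha *; set k := geo 1 _ in Hk *.
set h := (harmonic i 1)%:P in HH IH *; set s := harmonic_poly 1 i in Hh IH *.
have -> : T * ((1 - p%:R * a) * (1 - p%:R * k)) - (1 - p%:R * (h + a + (s + k)))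
  = (1 - p%:R * a) * (1 - p%:R * k) * (T - (1 - p%:R * (h + s)))
    + ((h + s) * (a + k) + a * k - p%:R * (h + s) * a * k) * p%:R ^+ 2.
  ring.
have Hp : p%:R \is a polyOver (zloc p) by rewrite rpred_nat.
have H1 : 1 \is a polyOver (zloc p) by rewrite rpred1.
by rewrite rpredD // polyOver_pmultM //; zloc_closed.
Qed.

(** Modulo p^2 the polynomial is the common factor of the weights times Y, the
    sum of their linear parts against the shifted harmonic numbers.  In the
    common factor the coefficients of degree 1 and 3 vanish modulo p^2, and that
    of degree 2 vanishes modulo p, so only the coefficients Y_3 modulo p^2 and
    Y_1 modulo p matter. *)
Lemma coef3_weighted_poly p :
  prime p -> (5 < p)%N -> (weighted_poly p)`_3 \in pmult p 2.
Proof.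
move=> p_pr p_gt5; have p_gt0 := prime_gt0 p_pr.
have z2 : 2^-1 \in zloc p by rewrite inv_zloc // coprime_lt //; lia.
pose V i : {poly rat} := 1 - p%:R * ((harmonic i 1)%:P + harmonic_poly 1 i).
pose Y := \sum_(0 <= i < p) V i * harmonic_poly 2^-1 i.
have Hh c i : c \in zloc p -> (i < p)%N -> harmonic_poly c i \is a polyOver (zloc p).
  exact: harmonic_poly_over.
have [c0 c1 c2 c3] := coef_scale_harmonic p.-1.
rewrite prednK // -/(weight_scale p) in c0 c1 c2 c3.
have h1 : harmonic p.-1 1 \in pmult p 2 by apply: harmonic_pmult2 => //; lia.
have h3 : harmonic p.-1 3 \in pmult p 2 by apply: harmonic_pmult2 => //; lia.
have h2 : harmonic p.-1 2 \in pmult p 1 by apply: harmonic_pmult1 => //; lia.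
have h4 : harmonic p.-1 4 \in pmult p 1 by apply: harmonic_pmult1 => //; lia.
have zh a : harmonic p.-1 a \in zloc p by apply: harmonic_zloc => //; lia.
have s1 : (weight_scale p)`_1 \in pmult p 2 by rewrite c1 rpredN.
have s2 : (weight_scale p)`_2 \in pmult p 1.
  apply: (@pmult_cancel _ _ 2); rewrite ?coprime_lt //; try lia.
  rewrite c2 rpredB // expr2 pmultMl //.
  exact: (pmult_le p_gt0 _ h1).
have s3 : (weight_scale p)`_3 \in pmult p 2.
  apply: (@pmult_cancel _ _ 6); rewrite ?prime_coprime //.
    apply/negP => /(dvdn_leq (isT : (0 < 6)%N)) p_le6.
    by have E : p = 6%N; [lia | rewrite E in p_pr].
  rewrite c3 rpredN !(rpredB, rpredD) //.
  - by rewrite exprS pmultMr // rpredX.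
  - by rewrite -mulrA pmultMl ?rpred_nat // pmultMr.
  - by rewrite pmultMl ?rpred_nat.
have VH i m : (m < 5)%N -> (V i)`_m = (m == 0)%:R
    - p%:R * ((m == 0)%:R * harmonic i 1 + harmonic i m.+1).
  move=> lt_m; rewrite /V coefB coefC -[p%:R]polyC_natr coefCM coefD coefC.
  rewrite coef_harmonic_poly // expr1n mul1r.
  by case: m lt_m => [|m] _ /=; rewrite ?mul1r ?mul0r.
have sumH a : \sum_(0 <= i < p) harmonic i a.+1
    = p%:R * harmonic p.-1 a.+1 - harmonic p.-1 a.
  by have := sum_harmonic p.-1 a; rewrite prednK // big_mkord.
have sumHM a b : (0 < a < 5)%N -> (0 < b < 5)%N -> odd (a + b) ->
    p%:R * \sum_(0 <= i < p) harmonic i a * harmonic i b \in pmult p 2.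
  move=> lt_a lt_b odd_ab; apply: (@pmultM p 1 1); first exact: (pmult_self 1 p_gt0).
  by rewrite big_mkord; apply: sum_harmonicM => //; lia.
have zp1 : p%:R \in pmult p 1 by exact: (pmult_self 1 p_gt0).
have zY : Y \is a polyOver (zloc p).
  rewrite /Y big_nat rpred_sum // => i lt_i.
  have Hi := Hh 1 i (rpred1 _) ltac:(lia); have Hi' := Hh _ i z2 ltac:(lia).
  have Hp : p%:R \is a polyOver (zloc p) by rewrite rpred_nat.
  have H1 : (harmonic i 1)%:P \is a polyOver (zloc p).
    by rewrite polyOverC harmonic_zloc //; lia.
  by rewrite rpredM // rpredB ?rpred1 // rpredM // rpredD.
have zYm m : Y`_m \in zloc p by apply/polyOverP.
have y1 : Y`_1 \in pmult p 1.
  rewrite /Y coef_sum.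
  have -> : \sum_(0 <= i < p) (V i * harmonic_poly 2^-1 i)`_1
    = 2^-1 * \sum_(0 <= i < p) harmonic i 2
      - p%:R * (2 * \sum_(0 <= i < p) harmonic i 1 * harmonic i 2).
    rewrite !mulr_sumr -sumrB; apply: eq_bigr => i _.
    by rewrite coefM1 !VH // !coef_harmonic_poly //=; field.
  rewrite rpredB //.
    by rewrite pmultMl // sumH rpredB ?pmultMr // (pmult_le p_gt0 _ h1).
  rewrite pmultMr // rpredM ?rpred_nat // big_nat rpred_sum // => i lt_i.
  by rewrite rpredM // harmonic_zloc //; lia.
have y3 : Y`_3 \in pmult p 2.
  rewrite /Y coef_sum.
  have -> : \sum_(0 <= i < p) (V i * harmonic_poly 2^-1 i)`_3
    = 2^-1 ^+ 3 * \sum_(0 <= i < p) harmonic i 4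
      - (5 * 2^-1 ^+ 2) * (p%:R * \sum_(0 <= i < p) harmonic i 1 * harmonic i 4)
      - (3 * 2^-1 ^+ 2) * (p%:R * \sum_(0 <= i < p) harmonic i 2 * harmonic i 3).
    rewrite !mulr_sumr -!sumrB; apply: eq_bigr => i _.
    by rewrite coefM3 !VH // !coef_harmonic_poly //=; field.
  rewrite !rpredB //; apply: pmultMl; try by zloc_closed.
  - by rewrite sumH rpredB // (pmultM zp1 h4).
  - exact: sumHM.
  - exact: sumHM.
(* Trading each tail for its linear part costs a multiple of p^2. *)
have -> : weighted_poly p = weight_scale p * Y
  + \sum_(0 <= i < p) weight_scale p * harmonic_poly 2^-1 i * (weight_tail p i - V i).
  rewrite /Y mulr_sumr -big_split; apply: eq_bigr => i _ /=.
  by rewrite [RHS]addrC; ring.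
have zs : weight_scale p \is a polyOver (zloc p).
  rewrite /weight_scale big_nat rpred_prod // => j lt_j.
  by rewrite rpredB ?rpred1 // polyOverZ ?polyOverX // inv_zloc // coprime_lt.
rewrite coefD rpredD //.
  rewrite coefM3 c0 mul1r !rpredD //.
  - by rewrite pmultMr.
  - exact: (pmultM s2 y1).
  - by rewrite pmultMr.
rewrite coef_sum big_nat rpred_sum // => i /andP[_ lt_i].
have /polyOverP : weight_scale p * harmonic_poly 2^-1 i * (weight_tail p i - V i)
    \is a polyOver (pmult p 2); last exact.
by rewrite polyOver_pmultM ?weight_tail_linear // rpredM // Hh.
Qed.

(** * Expansion of the generating function and conclusion *)

(** Each factor is 1 - 3x^2/(m^2 - x^2), that is 1 - 3x^2/m^2 up to x^4. *)
Lemma apery_product_expand p n x :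
  prime p -> (0 < n <= p)%N -> x \in pmult p 1 ->
  \prod_(1 <= m < n) ((m%:R ^+ 2 - (2 * x) ^+ 2) / (m%:R ^+ 2 - x ^+ 2))
    - (1 - 3 * x ^+ 2 * harmonic n.-1 2) \in pmult p 4.
Proof.
move=> p_pr; have p_gt0 := prime_gt0 p_pr; case: n => // n.
elim: n => [|n IH] lt_np px.
  by rewrite big_geq // harmonic0 mulr0 subr0 subrr rpred0.
have lt_n : (0 < n.+1 < p)%N by lia.
have {}IH := IH ltac:(lia) px; rewrite /= in IH *.
rewrite big_nat_recr //= harmonicS.
set Q := \prod_(1 <= m < n.+1) _ in IH *; set h := harmonic n 2 in IH *.
have zh : h \in zloc p by rewrite harmonic_zloc //; lia.
have nzk : n.+1%:R != 0 :> rat by rewrite pnatr_eq0.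
have nz := sqr_sub_neq0 p_pr lt_n px; have zi := inv_sqr_sub_zloc p_pr lt_n px.
have zk : n.+1%:R^-1 \in zloc p by rewrite inv_zloc // coprime_lt.
set k : rat := n.+1%:R in nzk nz zi zk *.
have zx := pmult_zloc p_gt0 px.
have -> : Q * ((k ^+ 2 - (2 * x) ^+ 2) / (k ^+ 2 - x ^+ 2))
    - (1 - 3 * x ^+ 2 * (h + 1 / k ^+ 2))
  = (1 - 3 * x ^+ 2 * (k ^+ 2 - x ^+ 2)^-1) * (Q - (1 - 3 * x ^+ 2 * h))
    + 3 * (3 * h - k^-1 ^+ 2) * (k ^+ 2 - x ^+ 2)^-1 * x ^+ 4.
  by clearbody k; field; rewrite nz nzk.
rewrite rpredD //; apply: pmultMl; try by zloc_closed.
exact: (pmultX 4 px).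
Qed.

(** The factor p compensates the denominators C(2k,k), which p may divide
    once. *)
Lemma apery_sum_expand p x :
  prime p -> x \in pmult p 1 ->
  p%:R * (apery_sum p.-1 x
    - 3 * \sum_(1 <= k < p) 1 / (k%:R ^+ 2 * 'C(2 * k, k)%:R)
    - 3 * x ^+ 2
      * (\sum_(1 <= k < p) 1 / (k%:R ^+ 4 * 'C(2 * k, k)%:R)
         - 3 * \sum_(1 <= k < p) harmonic k.-1 2 / (k%:R ^+ 2 * 'C(2 * k, k)%:R)))
    \in pmult p 4.
Proof.
move=> p_pr px; have p_gt0 := prime_gt0 p_pr.
rewrite /apery_sum prednK // (mulrBr (3 * x ^+ 2)) !mulr_sumr -!sumrB mulr_sumr.
rewrite big_nat rpred_sum // => k lt_k.
have nzk : k%:R != 0 :> rat by rewrite pnatr_eq0; lia.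
have zk : k%:R^-1 \in zloc p by rewrite inv_zloc // coprime_lt.
have nz := sqr_sub_neq0 p_pr lt_k px; have zi := inv_sqr_sub_zloc p_pr lt_k px.
have zC := central_bin_zloc p_pr (ltac:(lia) : (k < p)%N).
have nzC : 'C(2 * k, k)%:R != 0 :> rat by rewrite pnatr_eq0 -lt0n bin_gt0; lia.
have zh : harmonic k.-1 2 \in zloc p by rewrite harmonic_zloc //; lia.
have zx := pmult_zloc p_gt0 px.
have PQ := @apery_product_expand p k x p_pr ltac:(lia) px.
set Q := \prod_(1 <= m < k) _ in PQ *; set h := harmonic _ _ in zh PQ *.
set C : rat := 'C(2 * k, k)%:R in zC nzC *.
apply: (@mem_eq _ _ (p%:R / C * (3 * ((k%:R ^+ 2 - x ^+ 2)^-1 * (Q - (1 - 3 * x ^+ 2 * h))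
   + (k%:R^-1 ^+ 2 - 3 * h) * k%:R^-1 ^+ 2 * (k%:R ^+ 2 - x ^+ 2)^-1 * x ^+ 4)))).
  apply: pmultMl => //; apply: pmultMl; first exact: rpred_nat.
  rewrite rpredD //; apply: pmultMl; try by zloc_closed.
  exact: (pmultX 4 px).
by clearbody C Q h; field; rewrite nz nzk nzC.
Qed.

(** Up to the factor 2x, S(x) is a constant modulo p^4 on multiples of p once it
    is multiplied by the central binomial. *)
Lemma central_bin_apery_sum p x :
  prime p -> (5 < p)%N -> x \in pmult p 1 ->
  2 * x * ('C(2 * p.-1, p.-1)%:R * apery_sum p.-1 x - 2 * (weighted_poly p)`_1)
    \in pmult p 5.
Proof.
move=> p_pr p_gt5 px; have p_gt0 := prime_gt0 p_pr.
have px2 : 2 * x \in pmult p 1 by rewrite pmultMl ?rpred_nat.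
have nz j : (0 < j <= p.-1)%N -> (j%:R - x != 0) && (j%:R + x != 0).
  move=> lt_j; have lt_jp : (0 < j < p)%N by lia.
  rewrite (sub_pmult_neq0 p_pr lt_jp px) -[x]opprK.
  by rewrite (sub_pmult_neq0 p_pr lt_jp) ?rpredN.
have A := approx_weighted_sum p_pr (ltac:(lia) : (2 < p)%N).
have := approx_odd_part p_gt0 A (coef3_weighted_poly p_pr p_gt5) px2.
by rewrite -(apery_sum_weighted nz) => H; apply: mem_eq H _; ring.
Qed.

Theorem corollary1 (p : nat) (hp : prime p) (hp5 : (5 < p)%N) :
  ratcong p 1
    (\sum_(1 <= k < p) 1 / (k%:R ^+ 4 * 'C(2 * k, k)%:R)
     - 3 * \sum_(1 <= k < p) harmonic k.-1 2 / (k%:R ^+ 2 * 'C(2 * k, k)%:R))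
    0.
Proof.
apply: zloc_pmult1_ratcong => //.
have p_gt0 := prime_gt0 hp.
set T := _ - _.
have px : p%:R \in pmult p 1 by exact: (pmult_self 1 p_gt0).
have px2 : 2 * p%:R \in pmult p 1 by rewrite pmultMl ?rpred_nat.
have co2 : coprime p 2 by rewrite coprime_lt //; lia.
have co3 : coprime p 3 by rewrite coprime_lt //; lia.
set C : rat := 'C(2 * p.-1, p.-1)%:R.
have nzC : C != 0 by rewrite pnatr_eq0 -lt0n bin_gt0; lia.
set g := (weighted_poly p)`_1.
have S1 : C * apery_sum p.-1 p%:R - 2 * g \in pmult p 4.
  apply: (pmult_divp p_gt0); apply: (pmult_cancel co2) => //.
  by rewrite mulrA; apply: central_bin_apery_sum.
have S2 : C * apery_sum p.-1 (2 * p%:R) - 2 * g \in pmult p 4.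
  apply: (pmult_divp p_gt0); do 2!apply: (pmult_cancel co2) => //.
  by rewrite !mulrA -(mulrA 2); apply: central_bin_apery_sum.
have D : p%:R * (apery_sum p.-1 (2 * p%:R) - apery_sum p.-1 p%:R) \in pmult p 4.
  have zC : p%:R / C \in zloc p by apply: central_bin_zloc => //; lia.
  apply: mem_eq (pmultMl zC (rpredB S2 S1)) _.
  by clearbody C; field.
have E1 := apery_sum_expand hp px; have E2 := apery_sum_expand hp px2.
rewrite -/T in E1 E2.
(* Subtracting the two expansions leaves p * 3 * ((2p)^2 - p^2) * T = 9 p^3 T. *)
do 2!apply: (pmult_cancel co3) => //.
do 3!apply: (pmult_divp p_gt0).
by apply: mem_eq (rpredB D (rpredB E2 E1)) _; ring.
Qed.
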